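(* Let $W$ be a real random variable with an absolutely continuous distribution and finite moments of all orders, with mean $m$ and variance $\beta^2>0$. Let $\kappa_1=\mathbb{E}[(W-m)^4]/\beta^4-3$ and $\mu_6=\mathbb{E}[(W-m)^6]/\beta^6$. Consider the estimation of $\beta^2$ by the sample variance $\frac1n\sum_{i=1}^n(W_i-\overline W)^2$ of an iid sample $W_1,\dots,W_n$ of $W$. Then the quantity $A$ entering the acceleration constant $a$ of the bootstrap bias-corrected and accelerated technique (both defined in the context) is $$A=-\frac{-\mu_6+3\kappa_1+7}{(\kappa_1+2)^{3/2}} .$$ In particular, if $W$ is Gaussian, then $a=\dfrac{\sqrt2}{3\sqrt n}$, which does not depend on $m$ or $\beta^2$.
   Context: Let $\mathbf{X}=(W,W^2,W^3,W^4)$, $\boldsymbol\mu=\mathbb{E}\mathbf{X}$, $g(x_1,x_2)=x_2-x_1^2$, and for $\mathbf{x}=(x_1,\dots,x_4)$ define $h(\mathbf{x})\ge0$ by $$h^2(\mathbf{x})=\sum_{i=1}^2\sum_{j=1}^2\partial_ig(x_1,x_2)\,\partial_jg(x_1,x_2)\,(x_{i+j}-x_ix_j).$$ Let $A_s(\mathbf{x})=\big(g(x_1,x_2)-\beta^2\big)/h(\mathbf{x})$, $a_i=\partial_iA_s(\boldsymbol\mu)$, and $\mu_{i_1\ldots i_j}=\mathbb{E}\big[(W^{i_1}-\mathbb{E}W^{i_1})\cdots(W^{i_j}-\mathbb{E}W^{i_j})\big]$ for $1\le i_1,\dots,i_j\le4$. Then $$A=\sum_{i,j,k=1}^4a_ia_ja_k\mu_{ijk},\qquad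 a=\frac{A}{6\,\tau^3\sqrt n},\quad\text{where }\tau>0,\ \tau^2=\sum_{i,j=1}^4a_ia_j\mu_{ij}$$ (for this normalized function $\tau=1$). *)

(* Defs.v *)
From HB Require Import structures.
From mathcomp Require Import all_boot all_order all_algebra.
From mathcomp Require Import all_classical all_reals all_analysis.
From mathcomp Require Import ring lra.

Set Implicit Arguments.
Unset Strict Implicit.
Unset Printing Implicit Defensive.

Import Order.TTheory GRing.Theory Num.Theory.
Import numFieldNormedType.Exports.

Local Open Scope classical_set_scope.
Local Open Scope ring_scope.

(* Ordinals count from 0: an index i in {1, ..., N} is encoded as the element of
   'I_N with value i - 1. So the coordinate x_i of x : 'rV_4 is x 0 (inord i)
   for the encoded i, and x_(i+j) is x 0 (inord (i + j).+1). *)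

Definition partial (R : realType) (N : nat) (f : 'rV[R]_N.+1 -> R)
    (i : 'I_N.+1) (x : 'rV[R]_N.+1) : R :=
  'D_(delta_mx 0 i) f x.

Definition g (R : realType) (x : 'rV[R]_2) : R := x 0 1 - x 0 0 ^+ 2.

Definition coord12 (R : realType) (x : 'rV[R]_4) : 'rV[R]_2 :=
  \row_(i < 2) x 0 (inord i).

Definition h2 (R : realType) (x : 'rV[R]_4) : R :=
  \sum_(i < 2) \sum_(j < 2)
     partial (@g R) i (coord12 x) * partial (@g R) j (coord12 x) *
     (x 0 (inord (i + j).+1) - x 0 (inord i) * x 0 (inord j)).

(* Num.sqrt vanishes on negative numbers, so h x = 0 where h2 x < 0; the
   function is only used near points where h2 is positive. *)
Definition h (R : realType) (x : 'rV[R]_4) : R := Num.sqrt (h2 x).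

Definition A_s (R : realType) (beta : R) (x : 'rV[R]_4) : R :=
  (g (coord12 x) - beta ^+ 2) / h x.

Definition sample_variance (R : realType) (n : nat) (w : 'I_n -> R) : R :=
  n%:R^-1 * \sum_(i < n) (w i - n%:R^-1 * \sum_(j < n) w j) ^+ 2.

(* The sample variance is the function g of the sample mean of
   (W, W^2, W^3, W^4). *)
Lemma sample_varianceE (R : realType) (n : nat) (w : 'I_n -> R) : (0 < n)%N ->
  sample_variance w =
  g (coord12 (\row_(k < 4) (n%:R^-1 * \sum_(i < n) w i ^+ k.+1))).
Proof.
move=> n0; rewrite /g /coord12 !mxE !inordK//=.
have nn0 : n%:R != 0 :> R by rewrite pnatr_eq0 -lt0n.
set c := n%:R^-1 * \sum_(j < n) w j ^+ 1.
have cE : \sum_(j < n) w j = n%:R * c.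
  rewrite /c mulrA divff// mul1r.
  by apply: eq_bigr => i _; rewrite expr1.
rewrite /sample_variance cE mulKf//.
have -> : \sum_(i < n) (w i - c) ^+ 2 = \sum_(i < n) w i ^+ 2 - n%:R * c ^+ 2.
  rewrite (eq_bigr (fun i => w i ^+ 2 + (c ^+ 2 - w i * (2 * c)))); last first.
    by move=> i _; ring.
  rewrite big_split sumrB sumr_const card_ord /= -mulr_suml cE -mulr_natl.
  by ring.
by field.
Qed.

Section bca.
Context d (T : measurableType d) (R : realType) (P : probability T R).
Variable W : T -> R.

Definition Wpow (i : 'I_4) (t : T) : R := W t ^+ i.+1.

Definition mean_vec : 'rV[R]_4 := \row_(i < 4) fine 'E_P[Wpow i]%E.

(* mu_(i_1 ... i_j) for s = [:: i_1; ...; i_j] *)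
Definition joint_cmoment (s : seq 'I_4) : R :=
  fine 'E_P[fun t => (\prod_(i <- s) (Wpow i t - mean_vec 0 i))%R]%E.

Definition coef (beta : R) (i : 'I_4) : R :=
  partial (A_s beta) i mean_vec.

Definition bca_A (beta : R) : R :=
  \sum_(i < 4) \sum_(j < 4) \sum_(k < 4)
     coef beta i * coef beta j * coef beta k * joint_cmoment [:: i; j; k].

Definition bca_tau (beta : R) : R :=
  Num.sqrt (\sum_(i < 4) \sum_(j < 4)
     coef beta i * coef beta j * joint_cmoment [:: i; j]).

Definition bca_a (beta : R) (n : nat) : R :=
  bca_A beta / (6 * bca_tau beta ^+ 3 * Num.sqrt n%:R).

End bca.

Definition gaussian d (T : measurableType d) (R : realType)
    (P : probability T R) (W : {RV P >-> R}) : Prop :=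
  exists mu sigma : R, 0 < sigma /\
    forall B, measurable B -> distribution P W B = normal_prob mu sigma B.

(* Main.v *)
Require Import Defs.
From mathcomp Require Import all_boot all_order all_algebra.
From mathcomp Require Import all_classical all_reals all_analysis.
From mathcomp Require Import measurable_realfun ring lra.

Import Order.TTheory GRing.Theory Num.Theory.
Import numFieldNormedType.Exports.

Local Open Scope classical_set_scope.
Local Open Scope ring_scope.

(* At the mean vector mu the numerator of A_s vanishes, so the quotient rule leaves
   only the gradient of g: (a_1, a_2, a_3, a_4) = (-2m, 1, 0, 0) / h(mu). Hence
   sum_i a_i (W^i - E W^i) = ((W - m)^2 - beta^2) / h(mu), where h(mu)^2 is the
   variance of (W - m)^2, and A is the third moment of this normalized variable.
   Absolute continuity enters only through h(mu) > 0: otherwise W would be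
   concentrated on the two roots of (x - m)^2 = beta^2. In the Gaussian case the
   central moments of order 4 and 6 follow from Stein's identity
   E (W - m)^(k+1) = beta^2 k E (W - m)^(k-1). *)

(** * Directional derivatives and the gradient of [A_s] *)

(** Because [N x = 0], the difference quotient of [N / D] is that of [N] times the inverse of [D] at
    the displaced point. Continuity of [D] then suffices, and the square root in [h] is never
    differentiated. *)
Lemma derive_quotient_zero {R : realType} {V : normedModType R} (N D : V -> R)
    (x v : V) (dN : R) :
  is_derive x v N dN -> N x = 0 -> D x != 0 -> {for x, continuous D} ->
  'D_v (fun y => N y / D y) x = dN / D x.
Proof.
move=> [dvN <-] N0 D0 cD.
have cline : (fun t : R => t *: v + x) @ 0^' --> x.
  apply: cvg_within_filter.
  suff: (fun t : R => t *: v + x) @ 0 --> 0 *: v + x by rewrite scale0r add0r.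
  by apply: cvgD; [apply: cvgZr_tmp; exact: cvg_id|exact: cvg_cst].
have cDl : D (t *: v + x) @[t --> 0^'] --> D x by apply: cvg_comp cline cD.
apply/cvg_lim => //.
have H := cvgM dvN (cvgV D0 cDl).
rewrite [X in X @ _](_ : _ = (fun t => t^-1 *: (N (t *: v + x) - N x) *
  (D (t *: v + x))^-1)); first exact: H.
apply/funext => t /=.
by rewrite N0 mul0r !subr0 /GRing.scale/= mulrA.
Qed.

Lemma is_derive_coord {R : realType} {n : nat} (x v : 'rV[R]_n.+1) (j : 'I_n.+1) :
  is_derive x v (fun y : 'rV[R]_n.+1 => y 0 j) (v 0 j).
Proof.
have H : (fun h : R => h^-1 *:
    (((fun y : 'rV[R]_n.+1 => y 0 j) \o shift x) (h *: v) - x 0 j)) @ 0^' -->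
    v 0 j.
  apply/cvgrPdist_le => e e0; near=> t.
  rewrite /= !mxE addrK scalerA mulVf ?scale1r ?subrr ?normr0 ?ltW//.
  by near: t; exact: nbhs_dnbhs_neq.
by split; [apply/cvg_ex; exists (v 0 j)|exact: cvg_lim].
Unshelve. all: by end_near. Qed.

Lemma is_derive_g {R : realType} (y v : 'rV[R]_2) :
  is_derive y v (@g R) (v 0 1 - 2 * y 0 0 * v 0 0).
Proof.
have -> : @g R = (fun y : 'rV[R]_2 => y 0 1) - (fun y : 'rV[R]_2 => y 0 0) ^+ 2.
  by apply/funext => z; rewrite /g fctE exprfctE.
have d0 := is_derive_coord y v 0.
have d1 := is_derive_coord y v 1.
by apply: is_derive_eq; rewrite /GRing.scale/= expr1 mulr_natl.
Qed.

Lemma partial_gE {R : realType} (i : 'I_2) (y : 'rV[R]_2) :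
  partial (@g R) i y = if i == 0 then - (2 * y 0 0) else 1.
Proof.
rewrite /partial; have [_ ->] := is_derive_g y (delta_mx 0 i).
rewrite !mxE !eqxx /=.
by case: i => -[|[|//]] i1 /=; ring.
Qed.

Lemma g_coord12 {R : realType} (x : 'rV[R]_4) :
  g (coord12 x) = x 0 1 - x 0 0 ^+ 2.
Proof.
by rewrite /g /coord12 !mxE; congr (x 0 _ - x 0 _ ^+ 2); apply/val_inj;
  rewrite /= inordK.
Qed.

Lemma h2E {R : realType} (x : 'rV[R]_4) :
  h2 x = 4 * x 0 0 ^+ 2 * (x 0 1 - x 0 0 ^+ 2)
         - 4 * x 0 0 * (x 0 2 - x 0 0 * x 0 1) + (x 0 3 - x 0 1 ^+ 2).
Proof.
have inordE k (k4 : (k < 4)%N) (l : 'I_4) : k = l -> inord k = l.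
  by move=> kl; apply/val_inj; rewrite /= inordK.
rewrite /h2 !big_ord_recl !big_ord0 /= !partial_gE /coord12 !mxE /=.
rewrite (inordE 0 _ 0)// (inordE 1 _ 1)// (inordE 2 _ 2)// (inordE 3 _ 3)//.
ring.
Qed.

Lemma cvg_h2 {R : realType} (x : 'rV[R]_4) (F : set_system 'rV[R]_4) :
  Filter F -> (forall i, y 0 i @[y --> F] --> x 0 i) ->
  h2 y @[y --> F] --> h2 x.
Proof.
move=> FF c.
have c2 i : (y 0 i ^+ 2) @[y --> F] --> x 0 i ^+ 2.
  by apply: (cvg_comp _ (fun z : R => z ^+ 2) (c i)); exact: exprn_continuous.
have -> : @h2 R = fun x =>
  4 * x 0 0 ^+ 2 * (x 0 1 - x 0 0 ^+ 2)
         - 4 * x 0 0 * (x 0 2 - x 0 0 * x 0 1) + (x 0 3 - x 0 1 ^+ 2).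
  by apply/funext => z; rewrite h2E.
apply: cvgD; last by apply: cvgB; [exact: c|exact: c2].
apply: cvgB; apply: cvgM.
- by apply: cvgM; [exact: cvg_cst|exact: c2].
- by apply: cvgB; [exact: c|exact: c2].
- by apply: cvgM; [exact: cvg_cst|exact: c].
- by apply: cvgB; [exact: c|apply: cvgM; exact: c].
Qed.

Lemma partial_A_s {R : realType} (beta : R) (x : 'rV[R]_4) (i : 'I_4) :
  g (coord12 x) = beta ^+ 2 -> 0 < h2 x ->
  partial (A_s beta) i x = ((i == 1)%:R - 2 * x 0 0 * (i == 0)%:R) / h x.
Proof.
move=> gx h2x; rewrite /partial.
have c : {for x, continuous (@h R)}.
  apply: (@cvg_comp _ _ _ (@h2 R) Num.sqrt); last exact: sqrt_continuous.
  by apply: (cvg_h2 x (nbhs x)) => j; exact: coord_continuous.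
apply: (derive_quotient_zero (fun y => g (coord12 y) - beta ^+ 2)) => //.
- have -> : (fun y : 'rV[R]_4 => g (coord12 y) - beta ^+ 2) =
    (fun y : 'rV[R]_4 => y 0 1) - (fun y : 'rV[R]_4 => y 0 0) ^+ 2 - cst (beta ^+ 2).
    by apply/funext => z; rewrite g_coord12 !fctE.
  have d0 := is_derive_coord x (delta_mx 0 i) 0.
  have d1 := is_derive_coord x (delta_mx 0 i) 1.
  apply: is_derive_eq; rewrite /GRing.scale/= expr1 !mxE eqxx/= subr0 mulr_natl.
  by rewrite !(eq_sym i).
- by rewrite gx subrr.
- by rewrite gt_eqF// sqrtr_gt0.
Qed.

(** * Roots of polynomials and expectations of polynomials in [W] *)

(** Induction on a bound for the size: dividing by ['X - a%:P] at a root [a] lowers the size by one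
    and loses at most the root [a]. *)
Lemma finite_roots {R : realType} (p : {poly R}) :
  p != 0 -> finite_set [set x | root p x].
Proof.
move: {2}(size p) (leqnn (size p)) => n; elim: n p => [|n IH] p.
  by rewrite leqn0 size_poly_eq0 => ->.
move=> sp p0; have [[a ra]|nr] := pselect (exists a, root p a); last first.
  rewrite (_ : [set x | _] = set0)//; apply/seteqP; split => // x rx.
  by apply: nr; exists x.
have /factor_theorem[q pq] := ra.
have q0 : q != 0 by apply: contraNneq p0 => q0; rewrite pq q0 mul0r.
apply: (@sub_finite_set _ _ ([set x | root q x] `|` [set a])).
  by move=> x; rewrite /= pq rootM root_XsubC => /orP[|/eqP]; [left|right].
rewrite finite_setU; split; last exact: finite_set1.
apply: IH => //; move: sp; rewrite pq size_Mmonic ?monicXsubC// size_XsubC.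
by rewrite addnC.
Qed.

Section poly_expectation.
Context {d : measure_display} {T : measurableType d} {R : realType}.
Variables (P : probability T R) (W : {RV P >-> R}).
Hypothesis intW : forall k : nat, P.-integrable setT (fun t => (W t ^+ k)%:E).

(** All moments involved are expectations of polynomials in [W]. Taking the polynomial as argument
    settles integrability once and turns moment identities into [ring] identities in [{poly R}]. *)
Definition poly_expectation (p : {poly R}) : R := \int[P]_t p.[W t].
Local Notation Ew := poly_expectation.

Lemma integrable_poly (p : {poly R}) :
  P.-integrable setT (fun t => p.[W t]%:E).
Proof.
have -> : (fun t => p.[W t]%:E) =
    (fun t => \sum_(i < size p) (p`_i)%:E * (W t ^+ i)%:E)%E.
  by apply/funext => t; rewrite horner_coef sumEFin.
by apply: integrable_sum => // i _; exact: integrableZl.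
Qed.

Lemma poly_expectationD (p q : {poly R}) : Ew (p + q) = Ew p + Ew q.
Proof.
rewrite /Ew -RintegralD//; try exact: integrable_poly.
by apply: eq_Rintegral => t _; rewrite hornerD.
Qed.

Lemma poly_expectationZ (c : R) (p : {poly R}) : Ew (c *: p) = c * Ew p.
Proof.
rewrite /Ew -RintegralZl//; last exact: integrable_poly.
by apply: eq_Rintegral => t _; rewrite hornerZ.
Qed.

Lemma poly_expectationB (p q : {poly R}) : Ew (p - q) = Ew p - Ew q.
Proof. by rewrite -scaleN1r poly_expectationD poly_expectationZ mulN1r. Qed.

Lemma poly_expectationC (c : R) : Ew c%:P = c.
Proof.
rewrite /Ew; under eq_Rintegral do rewrite hornerC.
by have := expectation_cst P c; rewrite unlock /Rintegral => ->.
Qed.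

Lemma poly_expectation_sum (I : Type) (r : seq I) (F : I -> {poly R}) :
  Ew (\sum_(i <- r) F i) = \sum_(i <- r) Ew (F i).
Proof.
elim: r => [|i r IH]; first by rewrite !big_nil -[0]/(0%:P) poly_expectationC.
by rewrite !big_cons poly_expectationD IH.
Qed.

Lemma expectation_poly (f : T -> R) (p : {poly R}) :
  (forall t, f t = p.[W t]) -> 'E_P[f]%E = (Ew p)%:E.
Proof.
move=> fp; rewrite unlock /Ew /Rintegral fineK; last first.
  exact: integrable_fin_num (integrable_poly p).
by apply: eq_integral => t _; rewrite fp.
Qed.

(** A zero expectation would force [p.[W t] = 0] almost surely, putting [W] almost surely in the
    root set of [p]. That set is finite, hence Lebesgue-null, against absolute continuity. *)
Lemma poly_expectation_sqr_gt0 (p : {poly R}) :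
  distribution P W `<< @lebesgue_measure R -> p != 0 -> 0 < Ew (p ^+ 2).
Proof.
move=> /null_content_dominatesP dom p0.
rewrite lt_neqAle Rintegral_ge0 ?andbT; last first.
  by move=> t _; rewrite horner_exp sqr_ge0.
apply/eqP => Ep0.
have /integrableP[mp _] := integrable_poly (p ^+ 2).
have int0 : (\int[P]_t `|(p ^+ 2).[W t]%:E| = 0)%E.
  rewrite -[RHS]/(0%:E) {}Ep0 /Rintegral fineK.
    by apply: eq_integral => t _; rewrite gee0_abs// lee_fin horner_exp sqr_ge0.
  exact: integrable_fin_num (integrable_poly (p ^+ 2)).
have [N [mN PN0 subN]] := (ae_eq_integral_abs P measurableT mp).1 int0.
pose A := [set x | root p x].
have cA : countable A by apply: finite_set_countable; exact: finite_roots.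
have A0 : lebesgue_measure A = 0%E by exact: countable_lebesgue_measure0.
have mA : measurable A by apply: countable_measurable.
have PA0 : P (W @^-1` A) = 0%E by exact: dom A0.
have mWA : measurable (W @^-1` A).
  by rewrite -[X in measurable X]setTI; exact: measurable_funP.
(* Two null sets cover the whole space: [N], off which the polynomial vanishes at [W t], and the
   preimage of the root set [A]. *)
have : (P setT <= 0)%E.
  rewrite -[leRHS](adde0 0%E) -{1}PN0 -PA0.
  apply: le_trans (measureU2 _ mN mWA); apply: le_measure; rewrite ?inE//.
    exact: measurableU.
  move=> t _; have [pt|pt] := pselect (A (W t)); first by right.
  left; apply: subN => /(_ I) /= [] /eqP; rewrite horner_exp sqrf_eq0 => pt0.
  by apply: pt; rewrite /A /= rootE.
by rewrite probability_setT lee_fin ler10.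
Qed.

Lemma mean_vecE i : mean_vec P W 0 i = Ew 'X^(i.+1).
Proof.
rewrite mxE (@expectation_poly _ 'X^(i.+1))// => t.
by rewrite hornerXn.
Qed.

Definition centered_power (i : 'I_4) : {poly R} := 'X^(i.+1) - (Ew 'X^(i.+1))%:P.

Lemma joint_cmomentE (s : seq 'I_4) :
  joint_cmoment P W s = Ew (\prod_(i <- s) centered_power i).
Proof.
rewrite /joint_cmoment (@expectation_poly _ (\prod_(i <- s) centered_power i))//.
move=> t; rewrite horner_prod; apply: eq_bigr => i _.
by rewrite mean_vecE !hornerE.
Qed.

(** By linearity of the expectation, the triple sum is the expansion of the third moment of a single
    linear combination; likewise for [bca_tau] with the second moment. *)
Lemma bca_AE beta :
  bca_A P W beta = Ew ((\sum_(i < 4) coef P W beta i *: centered_power i) ^+ 3).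
Proof.
rewrite !exprS expr0 mulr1 mulr_suml poly_expectation_sum; apply: eq_bigr => i _.
rewrite mulr_suml mulr_sumr poly_expectation_sum; apply: eq_bigr => j _.
rewrite !mulr_sumr poly_expectation_sum; apply: eq_bigr => k _.
rewrite joint_cmomentE !big_cons big_nil mulr1.
by rewrite -!scalerAl -!scalerAr !poly_expectationZ /GRing.scale/= !mulrA.
Qed.

Lemma bca_tauE beta : bca_tau P W beta =
  Num.sqrt (Ew ((\sum_(i < 4) coef P W beta i *: centered_power i) ^+ 2)).
Proof.
congr Num.sqrt.
rewrite !exprS expr0 mulr1 mulr_suml poly_expectation_sum; apply: eq_bigr => i _.
rewrite !mulr_sumr poly_expectation_sum; apply: eq_bigr => j _.
rewrite joint_cmomentE !big_cons big_nil mulr1.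
by rewrite -!scalerAl -!scalerAr !poly_expectationZ /GRing.scale/= !mulrA.
Qed.

End poly_expectation.

(** * Integration by parts for the normal law *)

Lemma integral_normal_prob {R : realType} (m s : R) (f : R -> \bar R) :
  (normal_prob m s).-integrable setT f ->
  (\int[normal_prob m s]_x f x =
   \int[lebesgue_measure]_x (f x * (normal_pdf m s x)%:E))%E.
Proof.
move=> intf; have mf := measurable_int _ intf.
rewrite -(Radon_Nikodym_change_of_variables (normal_prob_dominates m s))//=.
apply: ae_eq_integral => //.
- by apply: emeasurable_funM => //; apply: (measurable_int lebesgue_measure);
    apply: Radon_Nikodym_integrable; exact: normal_prob_dominates.
- apply: emeasurable_funM => //=; apply/measurable_EFinP.
  exact: measurable_normal_pdf.
- apply: ae_eqe_mul2l => /=.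
  (* The Radon-Nikodym derivative is an abstract choice; it agrees almost everywhere with
     [normal_pdf] because both have the same integral over every measurable set. *)
  rewrite Radon_NikodymE//=; first exact: normal_prob_dominates.
  move=> dom; case: cid => /= h [h1 h2 h3].
  apply: integral_ae_eq => //=.
  + by apply/measurable_EFinP; exact: measurable_normal_pdf.
  + by move=> E _ mE; rewrite -h3.
Qed.

(** The density is nonnegative, so the change of measure applied to the absolute value of [f] gives
    the finite bound. *)
Lemma integrable_normal_prob {R : realType} (m s : R) (f : R -> \bar R) :
  (normal_prob m s).-integrable setT f ->
  lebesgue_measure.-integrable setT (fun x => f x * (normal_pdf m s x)%:E)%E.
Proof.
move=> intf; have mf := measurable_int _ intf.
apply/integrableP; split.
  apply: emeasurable_funM => //; apply/measurable_EFinP.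
  exact: measurable_normal_pdf.
have /integrableP[_ finf] := intf.
apply: (le_lt_trans _ finf).
have -> := integral_normal_prob m s _ (integrable_abse intf).
rewrite le_eqVlt; apply/orP; left; apply/eqP; apply: eq_integral => x _.
by rewrite abseM [X in (_ * X)%E]gee0_abs// lee_fin normal_pdf_ge0.
Qed.

Lemma is_derive_normal_fun {R : realType} (m s x : R) :
  s != 0 ->
  is_derive x 1 (normal_fun m s) (- (x - m) / s ^+ 2 * normal_fun m s x).
Proof.
move=> s0.
pose G := fun y : R => (- (s ^+ 2 *+ 2)^-1) * (y - m) ^+ 2.
have dG : is_derive x 1 G (- (x - m) / s ^+ 2).
  have -> : G = (- (s ^+ 2 *+ 2)^-1) \*: ((id - cst m) ^+ 2).
    by apply/funext => y; rewrite /G fctE.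
  apply: is_derive_eq.
  rewrite subr0 /GRing.scale/= expr1 !fctE mulr1 -mulr_natr invfM.
  by field.
have -> : normal_fun m s = expR \o G.
  by apply/funext => y; rewrite /normal_fun /G /= mulrC mulrN mulNr.
by apply: is_derive_eq; rewrite mulrC.
Qed.

(* At [k = 0] the truncated exponent [k.-1 = 0] is harmless: its factor is [0]. *)
Lemma is_derive_monomial_normal_pdf {R : realType} (m s : R) (k : nat) (x : R) :
  s != 0 ->
  is_derive x 1 (fun x => - s ^+ 2 * ((x - m) ^+ k * normal_pdf m s x))
    (((x - m) ^+ k.+1 - s ^+ 2 * k%:R * (x - m) ^+ k.-1) * normal_pdf m s x).
Proof.
move=> s0; have pdfE y : normal_pdf m s y = normal_peak s * normal_fun m s y.
  by rewrite normal_pdfE.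
have dn := is_derive_normal_fun m s x s0.
have -> : (fun x => - s ^+ 2 * ((x - m) ^+ k * normal_pdf m s x)) =
  cst (- s ^+ 2 * normal_peak s) * (((id - cst m) ^+ k) * normal_fun m s).
  by apply/funext => y; rewrite pdfE !fctE; rewrite /GRing.scale/=; ring.
apply: is_derive_eq.
rewrite pdfE !fctE subr0; rewrite /GRing.scale/= mulr1 (exprS (x - m)) -mulr_natr.
by field.
Qed.
(** For [n >= 1] one has [n <= n^2], and the exponential series gives
    [expR (c n) >= (c n)^(k+1) / (k+1)!]. One power more than [k] leaves the bound [K / n]. *)
Lemma cvg_exprn_gauss {R : realType} (c : R) (k : nat) : 0 < c ->
  (n%:R ^+ k * expR (- c * n%:R ^+ 2)) @[n --> \oo] --> (0 : R).
Proof.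
move=> c0; pose K : R := (k.+1)`!%:R / c ^+ k.+1.
apply: (@squeeze_cvgr _ _ _ _ (cst 0) (fun n : nat => K * n%:R^-1)).
- near=> n; have n0 : (0 < n)%N by near: n; exists 1%N.
  have nR : 0 < n%:R :> R by rewrite ltr0n.
  rewrite mulr_ge0 ?exprn_ge0 ?expR_ge0//=.
  have le1 : expR (- c * n%:R ^+ 2) <= (expR (c * n%:R))^-1.
    rewrite -expRN ler_expR mulNr lerN2 ler_pM2l//.
    by rewrite expr2 ler_peMl ?ler1n// ltW.
  apply: (le_trans (ler_wpM2l _ le1)); first by rewrite exprn_ge0.
  have le2 : (c * n%:R) ^+ k.+1 / (k.+1)`!%:R <= expR (c * n%:R).
    apply: le_trans (expR_ge1Dxn k _); first by rewrite lerDr.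
    by rewrite mulr_ge0 ?ltW.
  have f0 : 0 < (k.+1)`!%:R :> R by rewrite ltr0n fact_gt0.
  have d0 : 0 < (c * n%:R) ^+ k.+1 / (k.+1)`!%:R.
    by rewrite divr_gt0// exprn_gt0// mulr_gt0.
  apply: (@le_trans _ _ (n%:R ^+ k * ((c * n%:R) ^+ k.+1 / (k.+1)`!%:R)^-1)).
    by rewrite ler_wpM2l ?exprn_ge0// lef_pV2// posrE expR_gt0.
  rewrite le_eqVlt; apply/orP; left; apply/eqP.
  rewrite /K exprMn (exprS n%:R).
  field; rewrite !expf_neq0 ?gt_eqF//=.
- exact: cvg_cst.
- rewrite -[X in _ --> X](mulr0 K); apply: cvgM; first exact: cvg_cst.
  rewrite gtr0_cvgV0; first exact: cvgr_idn.
  by near=> n; rewrite ltr0n; near: n; exists 1%N.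
Unshelve. all: by end_near. Qed.

(** Dominated convergence, with the absolute value of [f] as dominating function. It reduces an
    integral over the line to compact intervals, where the fundamental theorem of calculus
    applies. *)
Lemma cvg_integral_itv_center {R : realType} (m : R) (f : R -> R) :
  (@lebesgue_measure R).-integrable setT (EFin \o f) ->
  (\int[lebesgue_measure]_(x in `[(m - n%:R)%R, (m + n%:R)%R]) (f x)%:E)%E @[n --> \oo]
    --> (\int[lebesgue_measure]_x (f x)%:E)%E.
Proof.
move=> intf; have mf := measurable_int _ intf.
have [| | |_ _] := @dominated_convergence _ _ _ (@lebesgue_measure R) setT measurableT
  (fun n => (EFin \o f) \_ `[m - n%:R, m + n%:R]%classic) (EFin \o f)
  (fun x => `|(f x)%:E|%E) _ mf _ (integrable_abse intf) _.
- move=> n; apply/(measurable_restrictT _ _).1 => //.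
  exact: measurable_funTS.
(* For fixed [x] the restricted function takes the value [f x] as soon as [n] is at least the
   distance from [x] to [m]. *)
- apply: aeW => x _; apply: cvg_near_cst; near=> n.
  rewrite patchE mem_set//= in_itv/= lerBlDr -lerBlDl.
  have : `|x - m| <= n%:R by near: n; exact: nbhs_infty_ger.
  by rewrite ler_norml => /andP[? ?]; apply/andP; split; lra.
- apply: aeW => x n _; rewrite patchE; case: ifP => //.
  by rewrite abse0 abse_ge0.
by rewrite /=; under eq_fun do rewrite -integral_mkcond.
Unshelve. all: by end_near. Qed.

(** The integrand times the density is the derivative of [- s ^+ 2 * ((x - m) ^+ k * normal_pdf m s
    x)], whose values at [m + n] and [m - n] tend to zero. *)
Lemma normal_stein {R : realType} (m s : R) (k : nat) : s != 0 ->
  (forall p : {poly R}, (normal_prob m s).-integrable setT (fun x => p.[x]%:E)) ->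
  \int[normal_prob m s]_x
    ((x - m) ^+ k.+1 - s ^+ 2 * k%:R * (x - m) ^+ k.-1) = 0.
Proof.
move=> s0 intp.
pose q := ('X - m%:P) ^+ k.+1 - (s ^+ 2 * k%:R) *: ('X - m%:P) ^+ k.-1.
pose G (x : R) : R := (x - m) ^+ k.+1 - s ^+ 2 * k%:R * (x - m) ^+ k.-1.
have GE : G = horner q by apply/funext => x; rewrite /G !hornerE.
have intG : (normal_prob m s).-integrable setT (EFin \o G) by rewrite GE; exact: intp.
pose F (x : R) : R := - s ^+ 2 * ((x - m) ^+ k * normal_pdf m s x).
have dF (x : R) : is_derive x 1 F (G x * normal_pdf m s x).
  exact: is_derive_monomial_normal_pdf.
have cF : continuous F.
  move=> x; apply: differentiable_continuous; apply/derivable1_diffP.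
  by case: (dF x).
have F0 : (F (m + n%:R) - F (m - n%:R))%:E @[n --> \oo] --> (0%:E : \bar R).
  apply: cvg_EFin; first exact: nearW.
  pose c := (s ^+ 2 *+ 2)^-1.
  have pdfE y : normal_pdf m s y = normal_peak s * normal_fun m s y.
    by rewrite normal_pdfE.
  have c0 : 0 < c by rewrite invr_gt0 mulrn_wgt0// exprn_even_gt0.
  (* The density is symmetric about [m], so the two boundary values differ only by the sign
     [(-1) ^+ k]. *)
  have -> : fine \o (fun n : nat => (F (m + n%:R) - F (m - n%:R))%:E) =
      fun n : nat => (- s ^+ 2 * normal_peak s * (1 - (-1) ^+ k)) *
        (n%:R ^+ k * expR (- c * n%:R ^+ 2)).
    apply/funext => n; rewrite /= /F !pdfE /normal_fun.
    have -> : m + n%:R - m = n%:R by ring.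
    have -> : m - n%:R - m = - n%:R by ring.
    rewrite sqrrN (exprNn n%:R) !mulNr (mulrC c) -/c; ring.
  rewrite -[X in _ --> X](mulr0 (- s ^+ 2 * normal_peak s * (1 - (-1) ^+ k))).
  by apply: cvgM; [exact: cvg_cst|exact: cvg_exprn_gauss].
have intf := integrable_normal_prob m s _ intG.
rewrite /Rintegral integral_normal_prob//.
have cint := cvg_integral_itv_center m (fun x => G x * normal_pdf m s x) intf.
suff : (\int[lebesgue_measure]_x (G x * normal_pdf m s x)%:E = 0%:E)%E by move=> ->.
(* The integrals over the intervals from [m - n] to [m + n] tend to the full integral; for [n >= 1],
   where the interval is nondegenerate, they equal the boundary differences, which tend to zero. *)
apply: cvg_unique cint _ => //.
apply: cvg_trans F0; apply: near_eq_cvg; near=> n.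
have n0 : (0 < n)%N by near: n; exists 1%N.
apply/esym/continuous_FTC2.
- by rewrite ltrD2l gtrN // ltr0n.
- apply: continuous_subspaceT => x; apply: cvgM; last exact: continuous_normal_pdf.
  by rewrite GE; exact: continuous_horner.
- split.
  + by move=> x _; case: (dF x).
  + by apply: cvg_at_right_filter; exact: cF.
  + by apply: cvg_at_left_filter; exact: cF.
- by move=> x _; rewrite derive1E; case: (dF x).
Unshelve. all: by end_near. Qed.

(** [normal_stein] transported along the law of [W]. Here [mu] and [s] are only the parameters of
    that law; the cases [k = 0] and [k = 1] later identify them with the mean and standard
    deviation. *)
Lemma gaussian_central_moment {d : measure_display} {T : measurableType d}
    {R : realType} (P : probability T R) (W : {RV P >-> R}) (mu s : R) (k : nat) :
  (forall k : nat, P.-integrable setT (fun t => (W t ^+ k)%:E)) ->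
  s != 0 -> (forall B, measurable B -> distribution P W B = normal_prob mu s B) ->
  poly_expectation P W (('X - mu%:P) ^+ k.+1) =
  s ^+ 2 * k%:R * poly_expectation P W (('X - mu%:P) ^+ k.-1).
Proof.
move=> intW s0 dW.
have mp (p : {poly R}) : measurable_fun setT (fun x => p.[x]%:E).
  by apply/measurable_EFinP; apply: continuous_measurable_fun; exact: continuous_horner.
(* [W] with values in [measurableTypeR R], the type carrying [normal_prob]: it
   has the same measurable sets as [R], but another display. *)
have mW : measurable_fun setT (W : T -> measurableTypeR R).
  exact: (@measurable_funP _ _ _ _ _ W).
pose X : {RV P >-> measurableTypeR R} := MeasurableFun.Pack
  (MeasurableFun.Class (isMeasurableFun.Build _ _ _ _ (W : T -> measurableTypeR R) mW)).
have eqint (f : R -> \bar R) :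
    (\int[normal_prob mu s]_x f x = \int[distribution P X]_x f x)%E.
  by apply/esym/eq_measure_integral => B mB _; exact: dW.
(* Integrability under the normal law is inherited from the finite moments of [W], through the image
   measure. *)
have intp (p : {poly R}) : (normal_prob mu s).-integrable setT (fun x => p.[x]%:E).
  have /integrableP[_ fin] := integrable_poly P W intW p.
  apply/integrableP; split; [exact: mp|apply: (le_lt_trans _ fin)].
  rewrite le_eqVlt; apply/orP; left; apply/eqP; apply: (etrans (eqint _)).
  by apply: ge0_integral_distribution => //; exact: (measurableT_comp _ (mp p)).
have Ewp (p : {poly R}) : poly_expectation P W p = \int[normal_prob mu s]_x p.[x].
  apply/esym; congr fine; apply: (etrans (eqint _)).
  by apply: integral_distribution; [exact: mp|exact: (integrable_poly P W intW p)].
apply/eqP; rewrite -subr_eq0; apply/eqP.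
apply: etrans (normal_stein mu s k s0 intp).
transitivity (poly_expectation P W (('X - mu%:P) ^+ k.+1 -
    (s ^+ 2 * k%:R) *: ('X - mu%:P) ^+ k.-1)).
  by rewrite poly_expectationB// poly_expectationZ.
by rewrite Ewp; apply: eq_Rintegral => x _; rewrite !hornerE.
Qed.

(** * Moments of the deviation [(W - m)^2 - beta^2] *)

Section bca_sample_variance.
Context {d : measure_display} {T : measurableType d} {R : realType}.
Variables (P : probability T R) (W : {RV P >-> R}) (m beta : R).
Hypothesis intW : forall k : nat, P.-integrable setT (fun t => (W t ^+ k)%:E).
Hypothesis distW : distribution P W `<< @lebesgue_measure R.
Hypothesis EW : 'E_P[W]%E = m%:E.
Hypothesis VW : 'V_P[W]%E = (beta ^+ 2)%:E.

Local Notation Ew := (poly_expectation P W).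
Local Notation central_moment k := (Ew (('X - m%:P) ^+ k)).

Lemma poly_expectationX : Ew 'X = m.
Proof.
move: EW; rewrite (expectation_poly P W intW W 'X).
  by move=> [].
by move=> t; rewrite hornerX.
Qed.

Lemma central_moment2 : central_moment 2 = beta ^+ 2.
Proof.
move: VW; rewrite /variance unlock EW.
rewrite (expectation_poly P W intW _ (('X - m%:P) ^+ 2)).
  by move=> [].
by move=> t; rewrite !hornerE !fctE expr2.
Qed.

Lemma poly_expectationX2 : Ew 'X^2 = beta ^+ 2 + m ^+ 2.
Proof.
rewrite -central_moment2.
have -> : ('X - m%:P) ^+ 2 = 'X^2 - (2 * m) *: 'X + (m ^+ 2)%:P :> {poly R}.
  by rewrite -mul_polyC; ring.
rewrite poly_expectationD// poly_expectationB// poly_expectationZ//.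
by rewrite poly_expectationC poly_expectationX; ring.
Qed.

(** At the mean vector, [h2] is the variance of [W^2 - 2 m W], which differs from [(W - m)^2] by a
    constant. The check expands both sides in raw moments. *)
Lemma h2_mean_vec : h2 (mean_vec P W) = central_moment 4 - beta ^+ 4.
Proof.
have -> : ('X - m%:P) ^+ 4 = 'X^4 - (4 * m) *: 'X^3 + (6 * m ^+ 2) *: 'X^2
    - (4 * m ^+ 3) *: 'X + (m ^+ 4)%:P :> {poly R}.
  by rewrite -!mul_polyC; ring.
rewrite poly_expectationD// poly_expectationB// poly_expectationD// poly_expectationB//.
rewrite !poly_expectationZ// poly_expectationC poly_expectationX.
rewrite h2E !mean_vecE//= poly_expectationX poly_expectationX2; ring.
Qed.

(** Completing the square: [W^2 - 2 m W] minus its mean is [(W - m)^2 - beta^2], since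
    [E W^2 = beta^2 + m^2]. *)
Lemma sum_coef_centered_power :
  0 < h2 (mean_vec P W) ->
  \sum_(i < 4) coef P W beta i *: centered_power P W i =
  (h (mean_vec P W))^-1 *: (('X - m%:P) ^+ 2 - (beta ^+ 2)%:P).
Proof.
move=> h2_gt0.
have gE : g (coord12 (mean_vec P W)) = beta ^+ 2.
  by rewrite g_coord12 !mean_vecE//= poly_expectationX poly_expectationX2; ring.
have coefE i : coef P W beta i =
    (h (mean_vec P W))^-1 * ((i == 1)%:R - 2 * m * (i == 0)%:R).
  by rewrite /coef partial_A_s// mulrC mean_vecE// poly_expectationX.
under eq_bigr do rewrite coefE -scalerA.
rewrite -scaler_sumr; congr (_ *: _).
rewrite !big_ord_recl big_ord0 /centered_power /= poly_expectationX poly_expectationX2.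
rewrite !mulr0 mulr1 sub0r !subr0 !scale0r scale1r /bump /= -mul_polyC; ring.
Qed.

Lemma poly_expectation_sqr_deviation :
  Ew ((('X - m%:P) ^+ 2 - (beta ^+ 2)%:P) ^+ 2) = central_moment 4 - beta ^+ 4.
Proof.
have -> : (('X - m%:P) ^+ 2 - (beta ^+ 2)%:P) ^+ 2 =
    ('X - m%:P) ^+ 4 - (2 * beta ^+ 2) *: ('X - m%:P) ^+ 2 + (beta ^+ 4)%:P.
  by rewrite -mul_polyC; ring.
rewrite poly_expectationD// poly_expectationB// poly_expectationZ//.
by rewrite poly_expectationC central_moment2; ring.
Qed.

Lemma h2_mean_vec_gt0 : 0 < h2 (mean_vec P W).
Proof.
rewrite h2_mean_vec -poly_expectation_sqr_deviation poly_expectation_sqr_gt0//.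
apply/eqP => p0.
(* The values at [m] and [m + 1] are [- beta^2] and [1 - beta^2], which cannot both be zero. *)
have := congr1 (horner^~ m) p0; have := congr1 (horner^~ (m + 1)) p0.
by rewrite /= !hornerE; lra.
Qed.

Lemma poly_expectation_cube_deviation :
  Ew ((('X - m%:P) ^+ 2 - (beta ^+ 2)%:P) ^+ 3) =
  central_moment 6 - 3 * beta ^+ 2 * central_moment 4 + 2 * beta ^+ 6.
Proof.
have -> : (('X - m%:P) ^+ 2 - (beta ^+ 2)%:P) ^+ 3 =
    ('X - m%:P) ^+ 6 - (3 * beta ^+ 2) *: ('X - m%:P) ^+ 4
    + (3 * beta ^+ 4) *: ('X - m%:P) ^+ 2 - (beta ^+ 6)%:P.
  by rewrite -!mul_polyC; ring.
rewrite poly_expectationB// poly_expectationD// poly_expectationB//.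
by rewrite !poly_expectationZ// poly_expectationC central_moment2; ring.
Qed.

Lemma bca_A_central_moment :
  bca_A P W beta = (central_moment 6 - 3 * beta ^+ 2 * central_moment 4
    + 2 * beta ^+ 6) / h (mean_vec P W) ^+ 3.
Proof.
rewrite bca_AE// sum_coef_centered_power ?h2_mean_vec_gt0// exprZn.
by rewrite poly_expectationZ// poly_expectation_cube_deviation exprVn mulrC.
Qed.

(** The second moment of the deviation is [h2 (mean_vec P W)], exactly the square of the normalizing
    factor. *)
Lemma bca_tau1 : bca_tau P W beta = 1.
Proof.
have h2_gt0 := h2_mean_vec_gt0.
rewrite bca_tauE// sum_coef_centered_power// exprZn poly_expectationZ//.
rewrite poly_expectation_sqr_deviation -h2_mean_vec exprVn sqr_sqrtr ?(ltW h2_gt0)//.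
by rewrite mulVf ?gt_eqF// sqrtr1.
Qed.

End bca_sample_variance.

Theorem mainTheorem6 (d : measure_display) (T : measurableType d)
    (R : realType) (P : probability T R) (W : {RV P >-> R})
    (m beta kappa1 mu6 : R) (n : nat) :
  distribution P W `<< @lebesgue_measure R ->
  (forall k : nat, P.-integrable setT (fun t => (W t ^+ k)%:E)) ->
  'E_P[W]%E = m%:E ->
  'V_P[W]%E = (beta ^+ 2)%:E ->
  0 < beta ->
  kappa1 = fine 'E_P[fun t => ((W t - m) ^+ 4)%R]%E / beta ^+ 4 - 3 ->
  mu6 = fine 'E_P[fun t => ((W t - m) ^+ 6)%R]%E / beta ^+ 6 ->
  (0 < n)%N ->
  bca_A P W beta =
    - ((- mu6 + 3 * kappa1 + 7) / (kappa1 + 2) `^ (3 / 2)) /\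
  (gaussian W ->
     bca_a P W beta n = Num.sqrt 2 / (3 * Num.sqrt n%:R)).
Proof.
move=> distW intW EW VW b0 k4E m6E n0.
have momentE k : 'E_P[fun t => ((W t - m) ^+ k)%R]%E =
    (poly_expectation P W (('X - m%:P) ^+ k))%:E.
  by apply: expectation_poly => // t; rewrite !hornerE.
set M4 := poly_expectation P W (('X - m%:P) ^+ 4).
set M6 := poly_expectation P W (('X - m%:P) ^+ 6).
have bN0 : beta != 0 by rewrite gt_eqF.
have M4E : M4 = beta ^+ 4 * (kappa1 + 3).
  by rewrite k4E momentE /= -/M4; field.
have M6E : M6 = beta ^+ 6 * mu6 by rewrite m6E momentE /= -/M6; field.
have h2E : h2 (mean_vec P W) = (beta ^+ 2) ^+ 2 * (kappa1 + 2).
  by rewrite (h2_mean_vec P W m beta)// -/M4 M4E; ring.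
have k2 : 0 < kappa1 + 2.
  have := h2_mean_vec_gt0 P W m beta intW distW EW VW.
  by rewrite h2E pmulr_rgt0// exprn_gt0// exprn_gt0.
pose S := Num.sqrt (kappa1 + 2).
have S0 : 0 < S by rewrite sqrtr_gt0.
have hE : h (mean_vec P W) = beta ^+ 2 * S.
  by rewrite /h h2E sqrtrM ?sqr_ge0// sqrtr_sqr ger0_norm// sqr_ge0.
(* The exponent is split as [2^-1 * 3], so that the real power becomes the cube of a square root and
   [field] can handle it. *)
have powE : (kappa1 + 2) `^ (3 / 2) = S ^+ 3.
  by rewrite mulrC powRrM powR12_sqrt ?(ltW k2)// powR_mulrn// ltW.
have AE : bca_A P W beta =
    - ((- mu6 + 3 * kappa1 + 7) / (kappa1 + 2) `^ (3 / 2)).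
  (* The numerator is [beta^6 (mu6 - 3 (kappa1 + 3) + 2)] and the denominator [beta^6 S^3], so the
     scale cancels. *)
  rewrite (bca_A_central_moment P W m beta)// -/M4 -/M6 M4E M6E hE powE.
  by field; rewrite bN0 gt_eqF.
split=> // -[mu [s [s0 dW]]].
have sN0 : s != 0 by rewrite gt_eqF.
have mom k := gaussian_central_moment P W mu s k intW sN0 dW.
(* At [k = 0] the right side of the recursion vanishes, so [W - mu] has mean zero. *)
have mum : mu = m.
  have := mom 0%N; rewrite mulr0 mul0r expr1 poly_expectationB//.
  rewrite poly_expectationC// (poly_expectationX P W m)// => /eqP.
  by rewrite subr_eq0 => /eqP.
rewrite mum in mom.
have s2 : s ^+ 2 = beta ^+ 2.
  have := mom 1%N; rewrite (central_moment2 P W m beta)// expr0.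
  by rewrite (poly_expectationC P W 1) => ->; rewrite !mulr1.
(* The recursion at [k = 3] and [k = 5] yields the factors [3] and [5 * 3 = 15]. *)
have M4g : M4 = 3 * beta ^+ 4.
  by rewrite /M4 (mom 3%N) /= (central_moment2 P W m beta)// s2; ring.
have M6g : M6 = 15 * beta ^+ 6.
  by rewrite /M6 (mom 5%N) /= -/M4 M4g s2; ring.
have k0 : kappa1 = 0 by rewrite k4E momentE /= -/M4 M4g; field.
have m15 : mu6 = 15 by rewrite m6E momentE /= -/M6 M6g; field.
have sqrtn : Num.sqrt n%:R != 0 :> R by rewrite gt_eqF// sqrtr_gt0 ltr0n.
have S2 : S ^+ 2 = 2 by rewrite sqr_sqrtr ?(ltW k2)// k0 add0r.
have SE : S = Num.sqrt 2 by rewrite /S k0 add0r.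
rewrite /bca_a (bca_tau1 P W m beta)// AE powE m15 k0 -SE exprS S2.
have SN0 : S != 0 by rewrite gt_eqF.
(* Here [A] is [8 / S^3] with [S^2 = 2]; expanding the target by [S] lets the same relation remove
   the square from its numerator. *)
have -> : S / (3 * Num.sqrt n%:R) = S ^+ 2 / (3 * S * Num.sqrt n%:R).
  by field; rewrite ?SN0 ?sqrtn.
by rewrite S2; field; rewrite ?SN0 ?sqrtn.
Qed.
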